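(* Let $X$ be a graph with exponentially many fat bigons. Then $X$ does not coarsely embed into any hyperbolic graph of uniformly bounded degree.
   Context: All graphs (in particular $X$) are connected, have uniformly bounded degree, and are metric spaces with the shortest path metric (edges of length 1). For $r\ge 0$, $B_r(x)$ is the closed ball of radius $r$ about $x$, and $N_r(Y)=\{x : d(x,Y)\le r\}$. Let $X$ be a graph with base vertex $x_0$, and let $x$ be a vertex. Given $L\ge 1$ and $s,C\ge 0$, an $(L,s,C)$-bigon at $x$ is a pair of paths $\alpha_1,\alpha_2$ in $X$ from $x_0$ to $x$ such that (1) the length satisfies $l(\alpha_i)\le L\,d(x_0,x)$ for $i=1,2$; (2) with $B=N_C(\{x_0,x\})$, we have $d(\alpha_1\setminus B,\alpha_2\setminus B)>s$ (this holds by convention if one of the two sets is empty). Let $\mathcal B^X(L,s,C)$ be the set of vertices $x$ such that there exists an $(L,s,C)$-bigon at $x$. $X$ has exponentially many fat bigons at $x_0$ if there exist constants $s_0,c,L>1$ such that for every $s\ge s_0$ there exists $C$ such that $|\mathcal B^X(L,s,C)\cap B_n(x_0)|\ge c^n$ for infinitely many $n\in\mathbb N$. This property does not depend on the choice of $x_0$. A coarse embedding of a graph $X$ into a graph $Y$, with vertex sets $VX$, $VY$, is a map $f:VX\to VY$ for which there are a constant $K\ge 1$ and a function $\rho:\mathbb N\to\mathbb N$ with $\rho(n)\to\infty$ as $n\to\infty$ such that $\rho(d_X(x,y))\le d_Y(f(x),f(y))\le K d_X(x,y)$ for all $x,y\in VX$. A graph is hyperbolic if it is $\delta$-hyperbolic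 for some $\delta$, i.e. for any geodesic triangle with sides $\gamma_1,\gamma_2,\gamma_3$ one has $\gamma_1\subseteq N_\delta(\gamma_2\cup\gamma_3)$. *)

(* Defs.v *)
From HB Require Import structures.
From mathcomp Require Import all_boot all_order all_algebra.
From mathcomp Require Import finmap.
From mathcomp Require Import all_classical all_reals all_analysis.

Set Implicit Arguments.
Unset Strict Implicit.
Unset Printing Implicit Defensive.

Import Order.TTheory GRing.Theory Num.Theory.
Import numFieldNormedType.Exports.

Local Open Scope classical_set_scope.
Local Open Scope ring_scope.
Local Open Scope card_scope.

(* Connected simple graphs, possibly infinite. A path starting at [u] is given
   by the sequence of its later vertices, so its length is its [size]. *)
Record graph := Graph {
  vertex :> choiceType;
  adj : rel vertex;
  adj_sym : symmetric adj;
  adj_irr : irreflexive adj;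
  graph_connected : forall u v : vertex,
    exists p : seq vertex, path adj u p /\ last u p = v }.

Definition bounded_degree (X : graph) : Prop :=
  exists D : nat, forall v : X, [set w : X | adj v w] #<= `I_D.

Section GraphDistance.
Variable X : graph.
Implicit Types u v : X.

Definition joined_by u v : pred nat := fun n =>
  `[< exists p : seq X, [/\ path (@adj X) u p, last u p = v & size p = n] >].

Lemma ex_joined_by u v : exists n, joined_by u v n.
Proof.
have [p [up uv]] := graph_connected u v.
by exists (size p); apply/asboolP; exists p.
Qed.

Definition gdist u v : nat := ex_minn (ex_joined_by u v).

End GraphDistance.

Section Realization.
Variables (R : realType) (X : graph).

(* Barycentric coordinates of the point at distance [t] from [u] on the edge
   [uv], or of the vertex [u] if [u = v]. *)
Definition segment_point (u v : X) (t : R) : X -> R :=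
  fun w => (1 - t) * (w == u)%:R + t * (w == v)%:R.

(* The metric graph obtained by gluing unit intervals along the edges of [X]. *)
Record realization := Realization {
  coord :> X -> R;
  coordP : exists (u v : X) (t : R),
    [/\ u = v \/ adj u v, 0 <= t <= 1 & coord = segment_point u v t] }.

Lemma vertex_coordP (v : X) : exists (u v' : X) (t : R),
  [/\ u = v' \/ adj u v', 0 <= t <= 1 &
      (fun w => (w == v)%:R) = segment_point u v' t].
Proof.
exists v, v, 0; split; [by left | by rewrite lexx ler01 |].
by apply/funext => w; rewrite /segment_point subr0 mul1r mul0r addr0.
Qed.

Definition vertex_point (v : X) : realization :=
  Realization (vertex_coordP v).

(* The closed edge [uv]; [cell u u] is the single point [vertex_point u]. *)
Definition cell (u v : X) : set realization :=
  [set p | forall w, p w != 0 -> w = u \/ w = v].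

(* Shortest path metric with edges of length 1: a shortest path from [p] to [q]
   either stays inside an edge [uv], and then has length [`|p u - q u|], or goes
   from [p] to an end [a] of its edge (length [1 - p a]), then to an end [b] of
   the edge of [q], then to [q]. *)
Definition dist (p q : realization) : R :=
  inf ([set l : R | exists u v : X,
          [/\ adj u v, cell u v p, cell u v q & l = `|p u - q u|] ] `|`
       [set l : R | exists a b : X,
          [/\ p a != 0, q b != 0 &
              l = (1 - p a) + (gdist a b)%:R + (1 - q b)] ]).

(* [+oo] if one of the two sets is empty. *)
Definition set_dist (A B : set realization) : \bar R :=
  ereal_inf [set d | exists p q, [/\ A p, B q & d = (dist p q)%:E] ].

Definition neighborhood (r : R) (A : set realization) : set realization :=
  [set p | (set_dist [set p] A <= r%:E)%E].

Fixpoint trace (u : X) (p : seq X) : set realization :=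
  if p is v :: p' then cell u v `|` trace v p' else cell u u.

Definition bigon (x0 x : X) (L s C : R) (p1 p2 : seq X) : Prop :=
  let B := neighborhood C [set vertex_point x0; vertex_point x] in
  [/\ path (@adj X) x0 p1 /\ last x0 p1 = x,
      path (@adj X) x0 p2 /\ last x0 p2 = x,
      (size p1)%:R <= L * (gdist x0 x)%:R,
      (size p2)%:R <= L * (gdist x0 x)%:R &
      (s%:E < set_dist (trace x0 p1 `\` B) (trace x0 p2 `\` B))%E].

Definition bigon_vertices (x0 : X) (L s C : R) : set X :=
  [set x | exists p1 p2, bigon x0 x L s C p1 p2].

Definition vertex_ball (x0 : X) (n : nat) : set X :=
  [set x | (gdist x0 x <= n)%N].

(* In a graph of bounded degree the balls are finite, so that [fset_set] is
   applied to finite sets only. *)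
Definition exp_many_fat_bigons (x0 : X) : Prop :=
  exists s0 c L : R, [/\ 1 < s0, 1 < c, 1 < L &
    forall s : R, s0 <= s -> exists2 C : R, 0 <= C &
      infinite_set [set n : nat |
        c ^+ n <=
          #|` fset_set (bigon_vertices x0 L s C `&` vertex_ball x0 n)|%:R] ].

Definition geodesic (x y : realization) (l : R) (g : R -> realization) : Prop :=
  [/\ 0 <= l, g 0 = x, g l = y &
      forall s t, s \in `[0, l] -> t \in `[0, l] -> dist (g s) (g t) = `|s - t|].

Definition delta_hyperbolic (delta : R) : Prop :=
  forall (x y z : realization) (l1 l2 l3 : R) (g1 g2 g3 : R -> realization),
    geodesic x y l1 g1 -> geodesic y z l2 g2 -> geodesic z x l3 g3 ->
    g1 @` `[0, l1] `<=`
      neighborhood delta (g2 @` `[0, l2] `|` g3 @` `[0, l3]).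

Definition hyperbolic : Prop := exists delta : R, delta_hyperbolic delta.

Lemma cell_vertex (u v x : X) : cell u v (vertex_point x) -> x = u \/ x = v.
Proof. by apply; rewrite /= eqxx oner_neq0. Qed.

(* [dist] extends the graph distance on the vertices. *)
Lemma dist_vertex (x y : X) :
  dist (vertex_point x) (vertex_point y) = (gdist x y)%:R.
Proof.
have mem : forall z w : X, (vertex_point z) w != 0 -> w = z.
  by move=> z w /=; case: (w =P z) => //; rewrite mulr0n eqxx.
rewrite /dist; set S := (X in inf X).
have Sxy : S (gdist x y)%:R.
  right; exists x, y; rewrite /= !eqxx oner_neq0; split => //.
  by rewrite subrr add0r addr0.
have lbS : lbound S (gdist x y)%:R.
  move=> l [[u [v [uv /cell_vertex xuv /cell_vertex yuv ->]]]|]; last first.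
    by case=> a [b [/mem -> /mem -> ->]]; rewrite /= !eqxx subrr add0r addr0.
  rewrite /gdist; case: ex_minnP => m _ mP /=.
  have same (z : X) : joined_by z z 0 by apply/asboolP; exists [::].
  have edge (z w : X) : adj z w -> joined_by z w 1.
    by move=> zw; apply/asboolP; exists [:: w]; rewrite /= zw.
  have nuv : (u == v) = false.
    by apply/negP => /eqP E; move: uv; rewrite E adj_irr.
  case: xuv yuv mP => -> [] -> mP.
  - by have := mP _ (same u); rewrite leqn0 => /eqP ->; exact: normr_ge0.
  - by rewrite eqxx nuv mulr0n subr0 normr1 -[1]/(1%:R) ler_nat mP ?edge.
  - rewrite nuv eqxx mulr0n sub0r normrN normr1 -[1]/(1%:R) ler_nat mP ?edge//.
    by rewrite adj_sym.
  - by have := mP _ (same v); rewrite leqn0 => /eqP ->; exact: normr_ge0.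
apply/eqP; rewrite eq_le; apply/andP; split.
  by apply: ge_inf => //; exists (gdist x y)%:R.
by apply: lb_le_inf => //; exists (gdist x y)%:R.
Qed.

End Realization.

Definition coarse_embedding (R : realType) (X Y : graph) (f : X -> Y) : Prop :=
  exists (K : R) (rho : nat -> nat), [/\ 1 <= K, rho @ \oo --> \oo &
    forall x y : X,
      (rho (gdist x y) <= gdist (f x) (f y))%N /\
      (gdist (f x) (f y))%:R <= K * (gdist x y)%:R].

(* Main.v *)
Require Import Defs.
From mathcomp Require Import all_boot all_order all_algebra.
From mathcomp Require Import finmap.
From mathcomp Require Import all_classical all_reals all_analysis.
From mathcomp Require Import zify ring lra.

Set Implicit Arguments.
Unset Strict Implicit.
Unset Printing Implicit Defensive.

Import Order.TTheory GRing.Theory Num.Theory.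

Local Open Scope classical_set_scope.
Local Open Scope nat_scope.

(** A coarse embedding [f] sends a fat bigon at [x] to two discrete paths of
    bounded step that join [f x0] to [f x], have length at most linear in
    [gdist x0 x], and stay far from each other away from their ends. In a
    hyperbolic graph this forces [gdist (f x0) (f x)] to be a small fraction of
    [gdist x0 x]. Indeed let [p] be a vertex on a geodesic from [f x0] to
    [f x], not too close to its ends. The two paths cannot both meet the ball
    of radius [T] about [p], since otherwise they would be close to each other
    there. A path that avoids this ball has to pass [p] at a distance of order
    [T] from the geodesic, and there, by hyperbolicity, the projection to the
    geodesic is nearly constant on balls whose radius is of order [T]; so the
    path spends a number of steps of order [T] while its projection advances by
    a bounded amount. Adding up along the geodesic ([two_paths_bound]), the
    total length of the two paths is at least of order [T] times
    [gdist (f x0) (f x)], up to an additive constant.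

    Hence for any [q], sufficiently fat bigons at vertices [x] of the ball of
    radius [n] satisfy [gdist (f x0) (f x) <= (n + k) %/ q] for a constant [k].
    Balls in the target grow at most exponentially and the fibers of [f] have
    bounded size, so there are at most [M * b ^ ((n + k) %/ q)] such vertices;
    if [q] is large this is below [c ^ n] for all but finitely many [n]
    ([exp_growth_contradiction]).

    Hyperbolicity enters through the four-point inequality on the vertices
    ([hyperbolic_four_point]), and the projection to the geodesic is replaced
    by a Gromov product ([progress]); both properties of the projection used
    above are then instances of that inequality ([slow_progress] and
    [avoid_far]). *)

(** * The graph metric *)

Section GraphMetric.
Variable X : graph.
Implicit Types u v w : X.

Lemma gdist_path u p : path (@adj X) u p -> gdist u (last u p) <= size p.
Proof.
move=> up; rewrite /gdist; case: ex_minnP => m _; apply.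
by apply/asboolP; exists p.
Qed.

Lemma shortest_path u v : exists p,
  [/\ path (@adj X) u p, last u p = v & size p = gdist u v].
Proof. by rewrite /gdist; case: ex_minnP => m /asboolP. Qed.

Lemma gdistxx u : gdist u u = 0.
Proof. by apply/eqP; rewrite -leqn0; exact: (@gdist_path u [::]). Qed.

Lemma gdist_eq0 u v : gdist u v = 0 -> u = v.
Proof.
move=> d0; have [p [_ lp sp]] := shortest_path u v.
by move: sp lp; rewrite d0 => /size0nil ->.
Qed.

Lemma gdist_adj u v : adj u v -> gdist u v <= 1.
Proof. by move=> uv; apply: (@gdist_path u [:: v]); rewrite /= uv. Qed.

Lemma gdist_triangle u v w : gdist u w <= gdist u v + gdist v w.
Proof.
have [p [up <- <-]] := shortest_path u v.
have [q [vq <- <-]] := shortest_path (last u p) w.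
by rewrite -size_cat -last_cat gdist_path// cat_path up.
Qed.

Lemma gdist_sym u v : gdist u v = gdist v u.
Proof.
wlog suff: u v / gdist u v <= gdist v u.
  by move=> H; apply/eqP; rewrite eqn_leq !H.
have [p [vp <- <-]] := shortest_path v u.
have lv : last (last v p) (rev (belast v p)) = v.
  by case: p {vp} => [|w p] //=; rewrite rev_cons last_rcons.
rewrite -{2}lv -(size_belast v p) -size_rev gdist_path// rev_path.
by under eq_path do rewrite adj_sym.
Qed.

(** Staying at [v] from time [gdist u v] on spares a special case for the last
    vertex: every point of a geodesic lies between two consecutive values. *)
Definition vertex_geodesic u v (w : nat -> X) :=
  [/\ w 0 = u, forall i, gdist u v <= i -> w i = v,
      forall i, i < gdist u v -> adj (w i) (w i.+1) &
      forall i, i <= gdist u v ->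
        gdist u (w i) = i /\ gdist (w i) v = gdist u v - i].

Lemma ex_vertex_geodesic u v : exists w : nat -> X, vertex_geodesic u v w.
Proof.
have [p [up lp sp]] := shortest_path u v.
have step i : i < gdist u v -> adj (nth v (u :: p) i) (nth v (u :: p) i.+1).
  by rewrite -sp => ip; move/(pathP v): up => /(_ i ip).
exists (nth v (u :: p)); split => //.
  move=> i; rewrite -sp leq_eqVlt => /orP[/eqP <-|ip].
    by rewrite -{2}lp (last_nth v).
  by rewrite nth_default.
have fromu i : i <= gdist u v -> gdist u (nth v (u :: p) i) <= i.
  elim: i => [|i IH] im; first by rewrite /= gdistxx.
  have := gdist_triangle u (nth v (u :: p) i) (nth v (u :: p) i.+1).
  have := gdist_adj (step _ im); have := IH (ltnW im); lia.
have tov k : k <= gdist u v -> gdist (nth v (u :: p) (gdist u v - k)) v <= k.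
  elim: k => [|k IH] km.
    by rewrite subn0 -{1}sp -last_nth lp gdistxx.
  have km' : gdist u v - k.+1 < gdist u v by lia.
  have := gdist_triangle (nth v (u :: p) (gdist u v - k.+1))
     (nth v (u :: p) (gdist u v - k)) v.
  have := gdist_adj (step _ km'); have := IH (ltnW km).
  have -> : (gdist u v - k.+1).+1 = gdist u v - k by lia.
  lia.
move=> i im; have := fromu i im; have := tov _ (leq_subr i (gdist u v)).
rewrite subKn// => A B; have := gdist_triangle u (nth v (u :: p) i) v; lia.
Qed.

Lemma vertex_geodesic_dist u v (w : nat -> X) i j : vertex_geodesic u v w ->
  i <= j <= gdist u v -> gdist (w i) (w j) = j - i.
Proof.
move=> [_ _ step dw] /andP[ij jm].
have [iu iv] := dw i (leq_trans ij jm); have [ju jv] := dw j jm.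
have up k : i + k <= gdist u v -> gdist (w i) (w (i + k)) <= k.
  elim: k => [|k IH] km; first by rewrite addn0 gdistxx.
  rewrite addnS in km *; have := gdist_triangle (w i) (w (i + k)) (w (i + k).+1).
  have := gdist_adj (step _ km); have := IH (ltnW km); lia.
have := gdist_triangle u (w i) (w j).
have := up (j - i); rewrite subnKC// => /(_ jm); lia.
Qed.

End GraphMetric.

(** * Distances in the metric graph *)

Section PointsOfTheRealization.
Variables (R : realType) (X : graph).
Local Open Scope ring_scope.

Lemma gdist_lipschitz (x a b : X) :
  `|(gdist x a)%:R - (gdist x b)%:R : R| <= (gdist a b)%:R.
Proof.
have A : (gdist x a)%:R <= (gdist x b)%:R + (gdist a b)%:R :> R.
  by rewrite -natrD ler_nat (gdist_sym a); exact: gdist_triangle.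
have B : (gdist x b)%:R <= (gdist x a)%:R + (gdist a b)%:R :> R.
  by rewrite -natrD ler_nat; exact: gdist_triangle.
rewrite ler_norml; lra.
Qed.

(** A point of an edge has only one pair of barycentric coordinates: a function
    on the vertices has the same affine interpolation at that point, whichever
    way the edge is presented. *)
Lemma segment_point_cell (u v a b : X) (t : R) (phi : X -> R) : u != v ->
  0 <= t <= 1 ->
  (forall w, segment_point a b t w != 0 -> w = u \/ w = v) ->
  (1 - t) * phi a + t * phi b =
  segment_point a b t u * phi u + segment_point a b t v * phi v.
Proof.
move=> uv /andP[t0 t1] ab.
have pick c : c = u \/ c = v ->
    (u == c)%:R * phi u + (v == c)%:R * phi v = phi c.
  case=> ->; rewrite eqxx; first by rewrite eq_sym (negPf uv) mul1r mul0r addr0.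
  by rewrite (negPf uv) mul1r mul0r add0r.
have Ea : (1 - t) * phi a = (1 - t) * ((u == a)%:R * phi u + (v == a)%:R * phi v).
  have [->|t1'] := eqVneq t 1; first by rewrite subrr !mul0r.
  rewrite pick//; apply: ab; rewrite /segment_point eqxx mulr1.
  rewrite gt_eqF// ltr_wpDr ?mulr_ge0// subr_gt0 lt_neqAle t1' //.
have Eb : t * phi b = t * ((u == b)%:R * phi u + (v == b)%:R * phi v).
  have [->|t0'] := eqVneq t 0; first by rewrite !mul0r.
  rewrite pick//; apply: ab; rewrite /segment_point eqxx mulr1.
  by rewrite gt_eqF// ltr_wpDl ?mulr_ge0 ?subr_ge0// lt_neqAle eq_sym t0'.
by rewrite Ea Eb /segment_point; ring.
Qed.

Lemma segment_point_sup (a b w : X) (t : R) :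
  segment_point a b t w != 0 -> w = a \/ w = b.
Proof.
rewrite /segment_point.
have [->|wa] := eqVneq w a; first by left.
have [->|wb] := eqVneq w b; first by right.
by rewrite !mulr0 addr0 eqxx.
Qed.

Lemma support_neq0 (p : realization R X) : exists w, p w != 0.
Proof.
have [a [b [t [_ /andP[t0 t1] ->]]]] := coordP p.
have [t0'|tle0] := ltP 0 t.
  exists b; rewrite /segment_point eqxx gt_eqF// ltr_wpDl ?mulr1//.
  by rewrite mulr_ge0 ?subr_ge0.
exists a; rewrite /segment_point eqxx gt_eqF// mulr1.
by rewrite ltr_pwDl ?mulr_ge0// subr_gt0 (le_lt_trans tle0).
Qed.

Lemma segment_point_height (x a b c : X) (t : R) : a = b \/ adj a b ->
  0 <= t <= 1 -> segment_point a b t c != 0 ->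
  `|(1 - t) * (gdist x a)%:R + t * (gdist x b)%:R - (gdist x c)%:R|
    <= 1 - segment_point a b t c.
Proof.
move=> [<-|ab] /andP[t0 t1] cs.
  have -> : c = a by case: (segment_point_sup cs).
  rewrite /segment_point eqxx !mulr1 subrK subrr -mulrDl subrK mul1r subrr.
  by rewrite normr0.
have nab : (a == b) = false.
  by apply/negP => /eqP E; move: ab; rewrite E adj_irr.
have le1 : `|(gdist x a)%:R - (gdist x b)%:R : R| <= 1.
  by apply: le_trans (gdist_lipschitz x a b) _; rewrite (ler_nat _ _ 1) gdist_adj.
case: (segment_point_sup cs) => ->; rewrite /segment_point eqxx.
- rewrite nab mulr1 mulr0 addr0.
  rewrite (_ : _ - (gdist x a)%:R =
      t * ((gdist x b)%:R - (gdist x a)%:R)); last by ring.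
  rewrite normrM (ger0_norm t0) distrC.
  rewrite (_ : 1 - _ = t * 1); last by ring.
  exact: ler_wpM2l.
- rewrite eq_sym nab mulr1 mulr0 add0r.
  rewrite (_ : _ - (gdist x b)%:R =
      (1 - t) * ((gdist x a)%:R - (gdist x b)%:R)); last by ring.
  have t1' : 0 <= 1 - t by lra.
  rewrite normrM (ger0_norm t1') -[leRHS]mulr1.
  exact: ler_wpM2l.
Qed.

(** The function [gdist x] on the vertices, extended affinely to the edges, is
    1-Lipschitz. This bounds distances from below along a geodesic from [x],
    where this function is the time. *)
Lemma dist_ge_height (x : X) (p q : realization R X) (a b a' b' : X) (t t' : R) :
  a = b \/ adj a b -> 0 <= t <= 1 -> p = segment_point a b t :> (X -> R) ->
  a' = b' \/ adj a' b' -> 0 <= t' <= 1 ->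
    q = segment_point a' b' t' :> (X -> R) ->
  `|((1 - t) * (gdist x a)%:R + t * (gdist x b)%:R)
    - ((1 - t') * (gdist x a')%:R + t' * (gdist x b')%:R)| <= dist p q.
Proof.
move=> ab ht Ep ab' ht' Eq.
rewrite /dist; apply: lb_le_inf.
  have [c pc] := support_neq0 p; have [d qd] := support_neq0 q.
  by exists ((1 - p c) + (gdist c d)%:R + (1 - q d)); right; exists c, d.
move=> l [[u [v [uv pu qu ->]]]|[c [d [pc qd ->]]]].
- have nuv : u != v by apply/eqP => E; move: uv; rewrite E adj_irr.
  rewrite /cell /= Ep in pu; rewrite /cell /= Eq in qu.
  have F phi := segment_point_cell phi nuv ht pu.
  have F' phi := segment_point_cell phi nuv ht' qu.
  rewrite (F (fun z => (gdist x z)%:R)) (F' (fun z => (gdist x z)%:R)) Ep Eq.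
  have := F (fun=> 1); have := F' (fun=> 1).
  rewrite !mulr1 !subrK => S' S.
  set A := segment_point a b t u in S *; set B := segment_point a b t v in S *.
  set A' := segment_point a' b' t' u in S' *.
  set B' := segment_point a' b' t' v in S' *.
  rewrite (_ : B = 1 - A); last by rewrite S; ring.
  rewrite (_ : B' = 1 - A'); last by rewrite S'; ring.
  rewrite (_ : _ - _ =
      (A - A') * ((gdist x u)%:R - (gdist x v)%:R)); last by ring.
  rewrite normrM ler_piMr//.
  by apply: le_trans (gdist_lipschitz x u v) _; rewrite (ler_nat _ _ 1) gdist_adj.
- rewrite Ep in pc *; rewrite Eq in qd *.
  have := segment_point_height x ab ht pc; have := segment_point_height x ab' ht' qd.
  have := gdist_lipschitz x c d.
  rewrite !ler_norml => /andP[? ?] /andP[? ?] /andP[? ?]; apply/andP; split; lra.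
Qed.

Lemma coord_le1 (p : realization R X) w : p w <= 1.
Proof.
have [a [b [t [_ /andP[t0 t1] ->]]]] := coordP p.
by rewrite /segment_point; case: (w == a); case: (w == b); rewrite ?mulr1 ?mulr0; lra.
Qed.

(** Rounds a point to a vertex of its edge. The second case comes from the
    points of an edge that ends at [v]. *)
Lemma near_vertex (v : X) (q : realization R X) (r : R) :
  dist (vertex_point R v) q < r ->
  exists2 b, q b != 0 & ((gdist v b)%:R < r) \/ (gdist v b <= 1)%N.
Proof.
have [d qd] := support_neq0 q.
rewrite /dist => /inf_lt[].
  exists ((1 - vertex_point R v v) + (gdist v d)%:R + (1 - q d)); right; exists v, d.
  by rewrite /= eqxx oner_neq0.
move=> l [[u [u' [uu' /cell_vertex vu qu _]]]|[c [e [vc qe ->]]]].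
- move=> _; exists d => //; right.
  have uu : (gdist u u' <= 1)%N by exact: gdist_adj.
  by case: vu => ->; case: (qu _ qd) => ->; rewrite ?gdistxx // gdist_sym.
- move: vc => /=; case: (c =P v) => [->|]; last by rewrite eqxx.
  rewrite mulr1n subrr add0r => _ lr; exists e => //; left.
  by have := coord_le1 q e; lra.
Qed.

Lemma segment_point_left (a b : X) (t : R) : 0 <= t <= 1 ->
  1 - t <= segment_point a b t a.
Proof.
by move=> /andP[t0 _]; rewrite /segment_point eqxx mulr1 lerDl mulr_ge0.
Qed.

Lemma segment_point_right (a b : X) (t : R) : 0 <= t <= 1 ->
  t <= segment_point a b t b.
Proof.
move=> /andP[_ t1]; rewrite /segment_point eqxx mulr1 lerDr mulr_ge0//.
by rewrite subr_ge0.
Qed.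

Lemma dist_le (p q : realization R X) (l : R) :
  (exists u v : X, [/\ adj u v, cell u v p, cell u v q & l = `|p u - q u|]) \/
  (exists a b : X, [/\ p a != 0, q b != 0 &
     l = (1 - p a) + (gdist a b)%:R + (1 - q b)]) ->
  dist p q <= l.
Proof.
move=> H; apply: ge_inf; last exact: H.
exists 0 => _ [[u [v [_ _ _ ->]]]|[a [b [_ _ ->]]]]; first exact: normr_ge0.
have := coord_le1 p a; have := coord_le1 q b; have := ler0n R (gdist a b); lra.
Qed.

Lemma dist_sym (p q : realization R X) : dist p q = dist q p.
Proof.
rewrite /dist; congr inf; apply/seteqP; split => l.
- case=> [[u [v [uv pu qu ->]]]|[a [b [pa qb ->]]]].
    by left; exists u, v; split => //; exact: distrC.
  by right; exists b, a; split => //; rewrite (gdist_sym b); ring.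
- case=> [[u [v [uv pu qu ->]]]|[a [b [pa qb ->]]]].
    by left; exists u, v; split => //; exact: distrC.
  by right; exists b, a; split => //; rewrite (gdist_sym b); ring.
Qed.

End PointsOfTheRealization.

(** * Geodesics in the metric graph *)

Section RealizedGeodesics.
Variables (R : realType) (X : graph).
Local Open Scope ring_scope.

(** The position at time [s] on the current edge; the maximum puts the negative
    times at a vertex, so that a path is defined on the whole line. *)
Definition path_time (s : R) : R := Num.max 0 (s - (Num.truncn s)%:R).

Lemma path_time01 s : 0 <= path_time s <= 1.
Proof.
rewrite /path_time le_max lexx ge_max ler01 /=.
have [s0|s0] := leP 0 s.
  by have /andP[_] := truncn_itv s0; rewrite -natr1; lra.
by rewrite lerBlDr (le_trans (ltW s0))// ler_wpDr.
Qed.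

Lemma path_timeE s : 0 <= s -> path_time s = s - (Num.truncn s)%:R.
Proof.
by move=> s0; apply: max_r; rewrite subr_ge0; have /andP[] := truncn_itv s0.
Qed.

Lemma path_coordP (g : nat -> X) : (forall i, g i = g i.+1 \/ adj (g i) (g i.+1)) ->
  forall s : R, exists (u v : X) (t : R), [/\ u = v \/ adj u v, 0 <= t <= 1 &
  segment_point (g (Num.truncn s)) (g (Num.truncn s).+1) (path_time s) =
  segment_point u v t].
Proof.
move=> hg s; exists (g (Num.truncn s)), (g (Num.truncn s).+1), (path_time s).
by split=> //; exact: path_time01.
Qed.

Lemma vertex_geodesic_step u v (g : nat -> X) : vertex_geodesic u v g ->
  forall i, g i = g i.+1 \/ adj (g i) (g i.+1).
Proof.
move=> [_ gv gs _] i; case: (ltnP i (gdist u v)) => im; first by right; apply: gs.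
by left; rewrite !gv// ltnW.
Qed.

Definition realize u v (g : nat -> X) (gg : vertex_geodesic u v g) (s : R) :=
  Realization (path_coordP (vertex_geodesic_step gg) s).

Lemma realize_nat u v (g : nat -> X) (gg : vertex_geodesic u v g) i :
  realize gg i%:R = vertex_point R (g i).
Proof.
have E : Defs.coord (realize gg i%:R) = Defs.coord (vertex_point R (g i)).
  apply/funext => w; rewrite /= /segment_point path_timeE ?ler0n// natrK subrr.
  by rewrite subr0 mul1r mul0r addr0.
move: E; case: (realize gg i%:R) => c cP; case: (vertex_point R (g i)) => c' c'P /=.
by move=> E; move: E cP c'P => <- cP c'P; congr Realization; exact: Prop_irrelevance.
Qed.

(** Distances are at least the elapsed time by [dist_ge_height], and at most
    the elapsed time because following the geodesic is one of the routes over
    which [dist] minimizes. *)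
Lemma realize_geodesic u v (g : nat -> X) (gg : vertex_geodesic u v g) :
  geodesic (vertex_point R u) (vertex_point R v) (gdist u v)%:R (realize gg).
Proof.
have [g0 gv gs gd] := gg; have gst := vertex_geodesic_step gg.
set m := gdist u v in gv gs gd *.
split; first exact: ler0n.
- by rewrite -[0]/(0%:R) realize_nat g0.
- by rewrite realize_nat gv.
suff H (s t : R) : 0 <= s -> s <= t -> t <= m%:R ->
    dist (realize gg s) (realize gg t) = t - s.
  move=> s t; rewrite !in_itv /= => /andP[s0 sm] /andP[t0 tm].
  have [st|/ltW ts] := leP s t.
    by rewrite (H _ _ s0 st tm) distrC ger0_norm ?subr_ge0.
  by rewrite dist_sym (H _ _ t0 ts sm) ger0_norm ?subr_ge0.
move=> s0 st tm; have t0 := le_trans s0 st.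
have height (r : R) : 0 <= r -> r <= m%:R ->
   (1 - path_time r) * (gdist u (g (Num.truncn r)))%:R
   + path_time r * (gdist u (g (Num.truncn r).+1))%:R = r.
  move=> r0 rm; rewrite path_timeE//; have /andP[kr rk] := truncn_itv r0.
  set k := Num.truncn r in kr rk *.
  have : (k <= m)%N by rewrite -(ler_nat R) (le_trans kr).
  rewrite leq_eqVlt => /orP[/eqP km|km]; last first.
    by have [-> _] := gd _ (ltnW km); have [-> _] := gd _ km; rewrite -natr1; ring.
  have -> : r = k%:R by apply/le_anti; rewrite kr km rm.
  by have [] := gd k; rewrite ?km// => -> _; ring.
apply/le_anti/andP; split; last first.
  have := dist_ge_height u (gst (Num.truncn s)) (path_time01 s)
    (erefl (Defs.coord (realize gg s)))
    (gst (Num.truncn t)) (path_time01 t) (erefl (Defs.coord (realize gg t))).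
  rewrite !height ?(le_trans st)//; apply: le_trans.
  by rewrite distrC ler_norm.
have := path_time01 s; have := path_time01 t; rewrite !path_timeE// => pt ps.
have [ks _] := andP (truncn_itv s0); have [kt _] := andP (truncn_itv t0).
have := Num.Theory.le_truncn st; rewrite leq_eqVlt => /orP[/eqP kk|kk]; last first.
  have ktm : (Num.truncn t <= m)%N by rewrite -(ler_nat R) (le_trans kt).
  have qb : 1 - path_time t <= realize gg t (g (Num.truncn t)).
    exact: segment_point_left (path_time01 t).
  have qb0 : realize gg t (g (Num.truncn t)) != 0.
    rewrite gt_eqF// (lt_le_trans _ qb)// path_timeE//.
    by have /andP[_] := truncn_itv t0; rewrite -natr1; lra.
  rewrite path_timeE// in qb.
  have [ps0|ps0] := leP (path_time s) 0; last first.
    have pa : path_time s <= realize gg s (g (Num.truncn s).+1).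
      exact: segment_point_right (path_time01 s).
    have pa0 : realize gg s (g (Num.truncn s).+1) != 0.
      by rewrite gt_eqF// (lt_le_trans ps0).
    apply: le_trans (dist_le (or_intror
      (ex_intro _ _ (ex_intro _ _ (And3 pa0 qb0 erefl))))) _.
    rewrite (vertex_geodesic_dist gg) ?kk// natrB// -natr1.
    by move: pa; rewrite path_timeE//; lra.
  have pa : 1 - path_time s <= realize gg s (g (Num.truncn s)).
    exact: segment_point_left (path_time01 s).
  have pa0 : realize gg s (g (Num.truncn s)) != 0.
    by rewrite gt_eqF// (lt_le_trans _ pa)//; lra.
  apply: le_trans (dist_le (or_intror
    (ex_intro _ _ (ex_intro _ _ (And3 pa0 qb0 erefl))))) _.
  rewrite (vertex_geodesic_dist gg) ?(ltnW kk)// natrB 1?ltnW//.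
  by move: pa ps0; rewrite path_timeE//; lra.
have ksm : (Num.truncn s <= m)%N by rewrite kk -(ler_nat R) (le_trans kt).
move: ksm; rewrite leq_eqVlt => /orP[/eqP km|km].
  have Es : s = m%:R by apply/le_anti; rewrite -{2}km ks (le_trans st).
  have Et : t = m%:R by apply/le_anti; rewrite tm -Es.
  by rewrite Es Et realize_nat dist_vertex gdistxx subrr.
have nab : (g (Num.truncn s) == g (Num.truncn s).+1) = false.
  by apply/negP => /eqP E; have := gs _ km; rewrite -E adj_irr.
have -> : t - s =
    `|realize gg s (g (Num.truncn s)) - realize gg t (g (Num.truncn s))|.
  rewrite /= -kk /segment_point eqxx nab !path_timeE// -kk !mulr1 !mulr0 !addr0.
  by rewrite -[LHS]ger0_norm ?subr_ge0//; congr (Num.norm _); ring.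
apply: dist_le; left; exists (g (Num.truncn s)), (g (Num.truncn s).+1).
split => //; first exact: gs.
  by move=> w; exact: segment_point_sup.
by move=> w; rewrite kk; exact: segment_point_sup.
Qed.

End RealizedGeodesics.

(** * From thin triangles to the four-point inequality *)

Section FourPoints.
Variable X : graph.

Lemma vertex_geodesic_mem (u v : X) (g : nat -> X) i : vertex_geodesic u v g ->
  gdist u (g i) + gdist (g i) v = gdist u v.
Proof.
move=> [_ gv _ gd]; have [im|/ltnW /gv ->] := leqP i (gdist u v); last first.
  by rewrite gdistxx addn0.
by have [-> ->] := gd _ im; rewrite subnKC.
Qed.

Lemma near_geodesic (R : realType) (u v x : X) (g : nat -> X)
    (gg : vertex_geodesic u v g) (t : R) N : 0 < N ->
  (dist (vertex_point R x) (realize gg t) < N%:R)%R ->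
  exists2 b, gdist x b <= N & gdist u b + gdist b v = gdist u v.
Proof.
move=> N0 /near_vertex[b bs near]; exists b.
  by case: near => [|/leq_trans]; [rewrite ltr_nat => /ltnW | apply].
by case: (segment_point_sup bs) => ->; exact: vertex_geodesic_mem.
Qed.

(** Thin triangles seen on the vertices: the sides of the triangle are realized
    in the metric graph, and the nearby point is rounded to a vertex. *)
Lemma hyperbolic_thin (R : realType) : hyperbolic R X -> exists N,
  forall (x y z : X) (g : nat -> X), vertex_geodesic x y g ->
  forall i, i <= gdist x y ->
  exists2 b, gdist (g i) b <= N &
    gdist y b + gdist b z = gdist y z \/ gdist z b + gdist b x = gdist z x.
Proof.
move=> [delta hyp]; exists (Num.truncn `|delta + 1|%R).+1 => x y z g gg i im.
have deltaN : (delta + 1 < (Num.truncn `|delta + 1|).+1%:R)%R.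
  by apply: le_lt_trans (ler_norm _) _; exact: truncnS_gt.
have [g2 gg2] := ex_vertex_geodesic y z; have [g3 gg3] := ex_vertex_geodesic z x.
have gi : (realize gg @` [set` `[0%R, (gdist x y)%:R%R]%R]) (vertex_point R (g i)).
  exists i%:R%R; last by rewrite realize_nat.
  by rewrite /= in_itv /= ler0n ler_nat.
have := hyp _ _ _ _ _ _ _ _ _ (realize_geodesic R gg) (realize_geodesic R gg2)
  (realize_geodesic R gg3) _ gi.
rewrite /neighborhood /= /set_dist => near.
have {near} : (ereal_inf [set d | exists p q, [/\ [set vertex_point R (g i)] p,
    (realize gg2 @` [set` `[0%R, (gdist y z)%:R%R]%R] `|`
     realize gg3 @` [set` `[0%R, (gdist z x)%:R%R]%R]) q
     & d = (dist p q)%:E]] < (delta + 1)%:E)%E.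
  by apply: le_lt_trans near _; rewrite lte_fin ltrDl.
move=> /ereal_inf_lt[_ [p [q [-> Aq ->]]]]; rewrite lte_fin => dpq.
have {}dpq := lt_trans dpq deltaN.
case: Aq => -[t _ tq]; rewrite -tq in dpq.
  by have [b ? ?] := near_geodesic (ltn0Sn _) dpq; exists b => //; left.
by have [b ? ?] := near_geodesic (ltn0Sn _) dpq; exists b => //; right.
Qed.

Definition four_point (D : nat) := forall x y z w : X,
  gdist x z + gdist y w <=
    maxn (gdist x y + gdist z w) (gdist y z + gdist x w) + D.

(** On a geodesic from [x] to [z] there is a vertex [v] near the sides from [y]
    to both [x] and [z], hence with [gdist x v + gdist v y] close to
    [gdist x y], and likewise for [z]. By thinness of the triangle on [x], [z]
    and [w], one of [x] and [z] also has this property with [w] instead of [y].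
    The inequality is the sum of that estimate and of the one for [y] and the
    other end. *)
Lemma hyperbolic_four_point (R : realType) : hyperbolic R X ->
  exists D, four_point D.
Proof.
move=> /hyperbolic_thin[N thin]; exists (4 * N + 2) => x y z w.
have [g gg] := ex_vertex_geodesic x z; have [g0 gv gs gd] := gg.
set m := gdist x z in gv gs gd *.
have near v i : i <= m ->
    gdist z (g i) + gdist (g i) v <= gdist z v + 2 * N \/
    gdist x (g i) + gdist (g i) v <= gdist x v + 2 * N.
  move=> im; have [b gb [bz|bx]] := thin _ _ v _ gg _ im.
    left; have := gdist_triangle z b (g i); have := gdist_triangle (g i) b v.
    by rewrite (gdist_sym b (g i)); lia.
  right; have := gdist_triangle x b (g i); have := gdist_triangle (g i) b v.
  by rewrite (gdist_sym b (g i)) (gdist_sym x b) (gdist_sym x v) (gdist_sym b v); lia.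
(* The last vertex near the side from [x] to [y]; its successor is near the
   other side. *)
have [i [im zi xi]] : exists i, [/\ i <= m,
    gdist z (g i) + gdist (g i) y <= gdist z y + 2 * N + 2 &
    gdist x (g i) + gdist (g i) y <= gdist x y + 2 * N].
  pose P i := (i <= m) && (gdist x (g i) + gdist (g i) y <= gdist x y + 2 * N).
  have exP : exists i, P i by exists 0; rewrite /P g0 gdistxx; lia.
  have ubP i : P i -> i <= m by case/andP.
  case: (ex_maxnP exP ubP) => i /andP[im xi] imax; exists i; split=> //.
  move: (im); rewrite leq_eqVlt => /orP[/eqP im'|im'].
    by rewrite gv ?im'// gdistxx; lia.
  have [zi|xi'] := near y i.+1 im'; last first.
    by have := imax i.+1; rewrite /P im' xi' ltnn => /(_ isT).
  have := gdist_triangle z (g i.+1) (g i).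
  have := gdist_triangle (g i) (g i.+1) y.
  by have := gdist_adj (gs _ im'); rewrite (gdist_sym (g i.+1) (g i)); lia.
have := gdist_triangle y (g i) w.
have [xi' zi'] := gd _ im; rewrite (gdist_sym z (g i)) zi' (gdist_sym (g i) y) in zi.
rewrite xi' (gdist_sym (g i) y) in xi.
have [H|H] := near w i im; [rewrite (gdist_sym z (g i)) zi' in H|rewrite xi' in H];
  rewrite (gdist_sym y z); lia.
Qed.

End FourPoints.

(** * Pairs of paths in a hyperbolic graph *)

Section Progress.
Variables (Y : graph) (D K : nat) (hD : four_point Y D) (y0 y : Y).
Local Notation m := (gdist y0 y).

(** Twice the Gromov product of [z] and [y] based at [y0]. Up to a bounded
    error, [z] projects to the geodesic from [y0] to [y] at half this distance
    from [y0]; it stands for the projection. *)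
Definition progress z := gdist z y0 + m - gdist z y.

Lemma gdist_le_progress z : gdist z y <= gdist z y0 + m.
Proof. exact: gdist_triangle. Qed.

Lemma progress_lipschitz z w : progress w <= progress z + 2 * gdist z w.
Proof.
rewrite /progress; have := gdist_le_progress z; have := gdist_le_progress w.
have := gdist_triangle w z y0; have := gdist_triangle z w y.
rewrite (gdist_sym w z); lia.
Qed.

(** A ball far from the geodesic has a projection of bounded diameter. The
    four-point inequality for [z], [w], [y], [y0] compares the two sums whose
    difference is the change of progress, unless the third sum,
    [gdist z w + m], is the larger one; the hypothesis excludes this. *)
Lemma slow_progress z w :
  2 * gdist z w + D + m < gdist z y0 + gdist z y ->
  progress w <= progress z + D.
Proof.
rewrite /progress => far; have := hD z w y y0.
have := gdist_le_progress z; have := gdist_le_progress w.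
have := gdist_triangle z w y0; rewrite (gdist_sym y y0); lia.
Qed.

(** A point that projects near [p] and is far from [p] is far from the whole
    geodesic: [gdist z y0 + gdist z y - m] is about twice its distance to it. *)
Lemma avoid_far j z p : gdist y0 p = j -> gdist p y = m - j -> j <= m ->
  2 * j <= progress z <= 2 * j + 2 * K ->
  2 * gdist z p + m <= gdist z y0 + gdist z y + 2 * K + 2 * D.
Proof.
rewrite /progress => pj pmj jm zj.
have := hD z y0 p y; have := gdist_le_progress z; rewrite pj pmj; lia.
Qed.

Lemma progress_start : progress y0 = 0.
Proof. by rewrite /progress gdistxx add0n subnn. Qed.

Lemma progress_end : progress y = 2 * m.
Proof. by rewrite /progress gdistxx (gdist_sym y y0) subn0 addnn mul2n. Qed.

Definition coarse_path (s : seq Y) :=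
  path (fun a b => gdist a b <= K) y0 s /\ last y0 s = y.

Definition hitting_time (s : seq Y) a := find (fun z => a <= progress z) (y0 :: s).

Lemma coarse_path_step s i : coarse_path s -> i < size s ->
  gdist (nth y0 (y0 :: s) i) (nth y0 (y0 :: s) i.+1) <= K.
Proof. by move=> [/(pathP y0) sp _] /sp. Qed.

Lemma coarse_path_dist s i k : coarse_path s -> i + k <= size s ->
  gdist (nth y0 (y0 :: s) i) (nth y0 (y0 :: s) (i + k)) <= K * k.
Proof.
move=> sp; elim: k => [|k IH] ik; first by rewrite addn0 gdistxx.
rewrite addnS in ik *.
have := gdist_triangle (nth y0 (y0 :: s) i) (nth y0 (y0 :: s) (i + k))
  (nth y0 (y0 :: s) (i + k).+1).
by have := coarse_path_step sp ik; have := IH (ltnW ik); rewrite mulnS; lia.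
Qed.

Lemma hitting_time_le s a : coarse_path s -> a <= 2 * m ->
  hitting_time s a <= size s.
Proof.
move=> [_ sy] am; rewrite -ltnS -[(size s).+1]/(size (y0 :: s)) -has_find.
by apply/hasP; exists y; rewrite ?progress_end// -sy mem_last.
Qed.

Lemma nth_hitting_time s a : coarse_path s -> a <= 2 * m ->
  a <= progress (nth y0 (y0 :: s) (hitting_time s a)).
Proof.
move=> sp am; apply: (nth_find y0 (a := fun z => a <= progress z)).
by rewrite has_find ltnS hitting_time_le.
Qed.

Lemma nth_hitting_time_le s a : coarse_path s -> a <= 2 * m ->
  progress (nth y0 (y0 :: s) (hitting_time s a)) <= a + 2 * K.
Proof.
move=> sp am; have := hitting_time_le sp am.
have := before_find y0 (s := y0 :: s) (a := fun z => a <= progress z).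
rewrite -/(hitting_time s a); case: (hitting_time s a) => [|i] before im.
  by rewrite /= progress_start.
have := before i (ltnSn _).
have := progress_lipschitz (nth y0 (y0 :: s) i) (nth y0 (y0 :: s) i.+1).
by have := coarse_path_step sp im; lia.
Qed.

Lemma hitting_time_homo s a b : coarse_path s -> a <= b -> b <= 2 * m ->
  hitting_time s a <= hitting_time s b.
Proof.
move=> sp ab bm; rewrite leqNgt; apply/negP => /(before_find y0).
by have := nth_hitting_time sp bm; lia.
Qed.

(** Passing slowly: on reaching progress [2 * j] the path is far from the
    geodesic, by [avoid_far], so that by [slow_progress] the next [r] steps gain
    at most [D]. The radius [K * r.+1 + 2 * D] suffices for these two lemmas
    when the path has steps of length [K]; the first point that reaches
    progress [2 * j] may overshoot by [2 * K], whence the increment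
    [K + D + 1]. *)
Lemma hitting_time_avoid s j r p : coarse_path s ->
  gdist y0 p = j -> gdist p y = m - j -> j + (K + D + 1) <= m ->
  (forall z, z \in y0 :: s -> K * r.+1 + 2 * D < gdist z p) ->
  hitting_time s (2 * j) + r <= hitting_time s (2 * (j + (K + D + 1))).
Proof.
move=> sp pj pmj jm avoid; set b := 2 * (j + _).
have am : 2 * j <= 2 * m by lia.
have bm : b <= 2 * m by rewrite /b; lia.
have ab : hitting_time s (2 * j) <= hitting_time s b.
  by apply: hitting_time_homo; rewrite // /b; lia.
have bs := hitting_time_le sp bm; have hb := nth_hitting_time sp bm.
have ha := nth_hitting_time sp am; have ha' := nth_hitting_time_le sp am.
rewrite leqNgt; apply/negP => lt.
set z := nth y0 (y0 :: s) (hitting_time s (2 * j)) in ha ha'.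
set w := nth y0 (y0 :: s) (hitting_time s b) in hb.
have zp : K * r.+1 + 2 * D < gdist z p.
  by apply: avoid; rewrite mem_nth// ltnS (leq_trans ab).
have zw : gdist z w <= K * r.
  have := coarse_path_dist (i := hitting_time s (2 * j))
    (k := hitting_time s b - hitting_time s (2 * j)) sp.
  rewrite subnKC// => /(_ bs) /leq_trans; apply.
  by rewrite leq_mul2l; lia.
have far := avoid_far pj pmj (z := z); rewrite ha ha' in far.
have {}far := far ltac:(lia) isT.
have := @slow_progress z w; rewrite mulnS in zp; rewrite /b in hb; lia.
Qed.

(** The sum of the two hitting times grows by at least [r] each time that the
    level moves [K + D + 1] forward along the geodesic, except within [E] of its
    ends, and it never exceeds the total length of the two paths. *)
Lemma two_paths_bound s1 s2 E r : coarse_path s1 -> coarse_path s2 ->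
  (forall p, E < gdist y0 p -> E < gdist p y ->
    (forall z, z \in y0 :: s1 -> K * r.+1 + 2 * D < gdist z p) \/
    (forall z, z \in y0 :: s2 -> K * r.+1 + 2 * D < gdist z p)) ->
  r * m <= (K + D + 1) * (size s1 + size s2)
           + r * ((K + D + 1) * (E + 2) + E + 1).
Proof.
set step := K + D + 1 => p1 p2 avoid.
have climb k : (E + 1 + k) * step + E < m ->
    r * k <= hitting_time s1 (2 * ((E + 1 + k) * step))
             + hitting_time s2 (2 * ((E + 1 + k) * step)).
  elim: k => [|k IH] km; first by rewrite muln0.
  set j := (E + 1 + k) * step in IH.
  have jS : (E + 1 + k.+1) * step = j + step by rewrite addnS mulSn addnC.
  rewrite jS in km *; have {}IH := IH ltac:(lia).
  have [g gg] := ex_vertex_geodesic y0 y; have [_ _ _ gd] := gg.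
  have [gj gmj] := gd j ltac:(lia).
  have Ej : E < j by rewrite /j /step; nia.
  have := avoid (g j); rewrite gj gmj => /(_ Ej) /(_ ltac:(lia)) Av.
  have mono s : coarse_path s ->
      hitting_time s (2 * j) <= hitting_time s (2 * (j + step)).
    by move=> sp; apply: hitting_time_homo => //; lia.
  have m1 := mono _ p1; have m2 := mono _ p2.
  case: Av => Av.
    have := hitting_time_avoid p1 gj gmj ltac:(lia) Av; rewrite -/step mulnS; lia.
  have := hitting_time_avoid p2 gj gmj ltac:(lia) Av; rewrite -/step mulnS; lia.
have step0 : 0 < step by rewrite /step; lia.
(* A geodesic too short to have any level away from its ends. *)
have [small|big] := leqP m ((E + 1) * step + E).
  by apply: leq_trans (leq_addl _ _); rewrite leq_mul2l; apply/orP; right; nia.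
set k := (m - ((E + 1) * step + E).+1) %/ step.
have kl := leq_trunc_div (m - ((E + 1) * step + E).+1) step.
have ku := ltn_ceil (m - ((E + 1) * step + E).+1) step0.
rewrite -/k in kl ku.
have km : (E + 1 + k) * step + E < m by nia.
have := climb k km.
have := hitting_time_le p1 (a := 2 * ((E + 1 + k) * step)) ltac:(lia).
have := hitting_time_le p2 (a := 2 * ((E + 1 + k) * step)) ltac:(lia).
move=> h2 h1 rk.
have mk : m <= step * k + (step * (E + 2) + E + 1) by nia.
have : r * m <= r * (step * k + (step * (E + 2) + E + 1)) by rewrite leq_mul2l mk orbT.
have : step * (r * k) <= step * (size s1 + size s2) by rewrite leq_mul2l; lia.
by rewrite (mulnDr r (step * k)) (mulnCA r step k); lia.
Qed.

End Progress.

(** * Growth and counting *)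

Section Counting.
Local Open Scope card_scope.

Lemma card_fset_set_cover (T : choiceType) (A : set T) (s : seq T) :
  A `<=` [set` s] -> #|` fset_set A| <= size s.
Proof.
move=> As; have finA := sub_finite_set As (finite_seq s).
apply: uniq_leq_size (fset_uniq _) _ => x.
by rewrite in_fset_set// inE => /As.
Qed.

Lemma ball_cover (X : graph) : bounded_degree X -> exists D, forall (v : X) n,
  exists2 s : seq X, size s <= D.+1 ^ n & forall w, gdist v w <= n -> w \in s.
Proof.
move=> [D hD]; exists D => v.
have nbrs u : exists2 s : seq X, size s <= D & forall w, adj u w -> w \in s.
  exists (fset_set [set w : X | adj u w]); first exact: geq_card_fset_set (hD u).
  have fin := card_le_finite (hD u) (finite_II D).
  by move=> w uw; rewrite in_fset_set// inE.
have [N NS NP] : exists2 N : X -> seq X, forall u, size (N u) <= D &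
    forall u w, adj u w -> w \in N u.
  by exists (fun u => s2val (cid2 (nbrs u))) => u; case: (cid2 (nbrs u)).
elim => [|n [s sn sP]].
  by exists [:: v] => // w; rewrite leqn0 => /eqP/gdist_eq0 <-; rewrite inE.
exists (flatten [seq u :: N u | u <- s]).
  rewrite size_flatten /shape -map_comp expnSr.
  apply: leq_trans (_ : size s * D.+1 <= _); last by rewrite leq_mul2r sn orbT.
  by elim: s {sn sP} => //= u s IH; rewrite mulSn leq_add// ltnS.
move=> w; rewrite leq_eqVlt => /orP[/eqP dw|wn]; last first.
  by apply/flatten_mapP; exists w; rewrite ?mem_head// sP.
have [g gg] := ex_vertex_geodesic v w; have [_ gv gs gd] := gg.
have nd : n < gdist v w by rewrite dw.
apply/flatten_mapP; exists (g n).
  by rewrite sP//; have [-> _] := gd _ (ltnW nd).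
by rewrite inE NP ?orbT// -(gv n.+1) ?dw//; exact: gs.
Qed.

Lemma fiber_cover (X Y : eqType) (f : X -> Y) (A : set X) (S : seq Y) M :
  (forall x, A x -> f x \in S) ->
  (forall x0, exists2 s : seq X, size s <= M & forall x, f x = f x0 -> x \in s) ->
  exists2 s : seq X, size s <= M * size S & A `<=` [set` s].
Proof.
move=> AS fib.
suff [s sM sP] : exists2 s : seq X, size s <= M * size S &
    forall x, f x \in S -> x \in s by exists s => // x /AS; apply: sP.
elim: S {A AS} => [|y S [s sM sP]]; first by exists [::].
have [[x0 <-]|nox] := pselect (exists x0, f x0 = y).
  have [s0 s0M s0P] := fib x0; exists (s0 ++ s).
    by rewrite size_cat mulnS leq_add.
  by move=> x; rewrite inE mem_cat => /orP[/eqP/s0P -> //|/sP ->]; rewrite orbT.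
exists s; first by rewrite (leq_trans sM)// leq_mul2l leqnSn orbT.
by move=> x; rewrite inE => /orP[/eqP fx|/sP//]; case: nox; exists x.
Qed.

(** By Bernoulli's inequality. *)
Lemma exists_expr_ge (R : realType) (c x : R) :
  (1 < c -> exists n, x <= c ^+ n)%R.
Proof.
move=> c1; have bern n : (1 + n%:R * (c - 1) <= c ^+ n)%R.
  elim: n => [|n IH]; first by rewrite mul0r addr0 expr0.
  rewrite exprS -natr1; have n0 := ler0n R n; have c0 : (0 <= c)%R by lra.
  by have := ler_wpM2l c0 IH; have := mulr_ge0 n0 (sqr_ge0 (c - 1)%R); lra.
have c0 : (0 < c - 1)%R by lra.
exists (Num.truncn `|x / (c - 1)|%R).+1; apply: le_trans (bern _).
have := truncnS_gt `|x / (c - 1)|%R; have := ler_norm (x / (c - 1))%R.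
move=> /le_lt_trans H /H; rewrite ltr_pdivrMr//; lra.
Qed.

(** Raised to the power [q], the inequality gives [(2 * b) ^ n] at most
    [M ^ q * b ^ (n + k)], that is [2 ^ n <= M ^ q * b ^ k], which bounds
    [n]. *)
Lemma exp_growth_contradiction (R : realType) (c : R) (b q M k : nat) :
  (0 < q)%N -> ((2 * b)%:R <= c ^+ q)%R -> (0 <= c)%R -> (0 < b)%N ->
  ~ infinite_set [set n | c ^+ n <= (M * b ^ ((n + k) %/ q))%:R]%R.
Proof.
move=> q0 bc c0 b0; apply; apply: sub_finite_set (finite_II (M ^ q * b ^ k)).
move=> n /= cn; apply: leq_trans (ltn_expl n (ltnSn 1)) _.
rewrite -(leq_pmul2r (m := b ^ n)) ?expn_gt0 ?b0// -expnMn -mulnA -expnD.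
have : (((2 * b) ^ n)%:R <= ((M * b ^ ((n + k) %/ q)) ^ q)%:R :> R)%R.
  rewrite !natrX; apply: le_trans (_ : (c ^+ q) ^+ n <= _)%R.
    by apply: lerXn2r => //; rewrite nnegrE ?exprn_ge0.
  by rewrite exprAC lerXn2r// nnegrE ?exprn_ge0// (le_trans _ cn) ?exprn_ge0.
rewrite ler_nat => /leq_trans; apply; rewrite expnMn leq_mul2l -expnM.
by rewrite leq_pexp2l ?orbT// addnC leq_trunc_div.
Qed.

End Counting.

(** * Fat bigons and their images *)

Section Bigons.
Variables (R : realType) (X : graph).

Lemma trace_vertex (u : X) p a : a \in u :: p -> @trace R X u p (vertex_point R a).
Proof.
have vc x y : cell x y (vertex_point R x).
  by move=> w /=; case: (w =P x) => [->|_]; [left|rewrite eqxx].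
elim: p u => [|v p IH] u /=; first by rewrite inE => /eqP ->.
by rewrite inE => /orP[/eqP ->|/IH]; [left|right].
Qed.

Lemma not_near_ends (x0 x a : X) (C : R) :
  (C < (gdist a x0)%:R)%R -> (C < (gdist a x)%:R)%R ->
  ~ neighborhood C [set vertex_point R x0; vertex_point R x] (vertex_point R a).
Proof.
move=> C0 Cx; rewrite /neighborhood /= leNgt => /negP; apply.
apply: (@lt_le_trans _ _ (Num.min (gdist a x0)%:R (gdist a x)%:R)%:E).
  by rewrite lte_fin lt_min C0 Cx.
apply: le_ereal_inf_tmp => _ [p [q [-> [->|->] ->]]];
  by rewrite lee_fin dist_vertex ge_min lexx ?orbT.
Qed.

Lemma bigon_apart (x0 x a b : X) (L s C : R) p1 p2 : bigon x0 x L s C p1 p2 ->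
  a \in x0 :: p1 -> b \in x0 :: p2 ->
  (C < (gdist a x0)%:R)%R -> (C < (gdist a x)%:R)%R ->
  (C < (gdist b x0)%:R)%R -> (C < (gdist b x)%:R)%R ->
  (s < (gdist a b)%:R)%R.
Proof.
move=> [_ _ _ _ sd] ap bp a0 ax b0 bx; rewrite -lte_fin.
apply: lt_le_trans sd _; apply: ereal_inf_lbound.
exists (vertex_point R a), (vertex_point R b); split.
- by split; [exact: trace_vertex|exact: not_near_ends].
- by split; [exact: trace_vertex|exact: not_near_ends].
- by rewrite dist_vertex.
Qed.

End Bigons.

Section BigonImages.
Variables (R : realType) (X Y : graph) (f : X -> Y) (D K : nat).
Hypotheses (hD : four_point Y D)
  (fK : forall u v, gdist (f u) (f v) <= K * gdist u v).

Lemma coarse_path_map (u v : X) p : path (@adj X) u p -> last u p = v ->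
  coarse_path K (f u) (f v) (map f p).
Proof.
move=> up <-; split; last by rewrite last_map.
rewrite path_map; apply: sub_path up => a b ab /=.
by rewrite (leq_trans (fK a b))// -[leqRHS]muln1 leq_mul2l gdist_adj// orbT.
Qed.

(** If both image paths meet the ball of radius [K * r.+1 + 2 * D] about a
    vertex [p], they do so at the images of vertices [a] and [b] with
    [gdist a b <= N]. So [a] or [b] is within [C] of [x0] or [x], and [p] is
    within [E] of an end of the geodesic: [two_paths_bound] applies. *)
Lemma bigon_image (x0 x : X) (L s C : R) p1 p2 (L' C' N r E : nat) :
  E = K * C' + (K * r.+1 + 2 * D) ->
  bigon x0 x L s C p1 p2 -> (L <= L'%:R)%R -> (C <= C'%:R)%R -> (N%:R <= s)%R ->
  (forall u v, N < gdist u v -> 2 * (K * r.+1 + 2 * D) < gdist (f u) (f v)) ->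
  r * gdist (f x0) (f x) <= (K + D + 1) * (2 * L' * gdist x0 x)
                            + r * ((K + D + 1) * (E + 2) + E + 1).
Proof.
move=> EE big LL' CC' Ns far.
have [[up1 lp1] [up2 lp2] sz1 sz2 _] := big.
set T := K * r.+1 + 2 * D in EE far *.
have size_le p : ((size p)%:R <= L * (gdist x0 x)%:R)%R ->
    size (map f p) <= L' * gdist x0 x.
  move=> sz; rewrite size_map -(ler_nat R) natrM (le_trans sz)//.
  by rewrite ler_wpM2r.
apply: (@leq_trans ((K + D + 1) * (size (map f p1) + size (map f p2))
    + r * ((K + D + 1) * (E + 2) + E + 1))); last first.
  by rewrite leq_add2r leq_mul2l -mulnA mul2n -addnn leq_add ?orbT// size_le.
apply: (two_paths_bound hD (coarse_path_map up1 lp1) (coarse_path_map up2 lp2)).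
move=> p E0 E1; rewrite -/T.
have [/allP|/allPn[z1]] := boolP (all (fun z => T < gdist z p) (f x0 :: map f p1)).
  by left.
rewrite -map_cons => /mapP[a ap ->] {z1}; rewrite -leqNgt => az.
have [/allP|/allPn[z2]] := boolP (all (fun z => T < gdist z p) (f x0 :: map f p2)).
  by right.
rewrite -map_cons => /mapP[b bp ->] {z2}; rewrite -leqNgt => bz.
have away c w : gdist (f c) p <= T -> E < gdist p (f w) ->
    (C < (gdist c w)%:R)%R.
  move=> cp pw; apply: le_lt_trans CC' _; rewrite ltr_nat ltnNge.
  apply/negP => cw; have := fK c w; have := gdist_triangle p (f c) (f w).
  have : K * gdist c w <= K * C' by rewrite leq_mul2l cw orbT.
  by rewrite (gdist_sym p (f c)); lia.
rewrite gdist_sym in E0.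
have := bigon_apart big ap bp (away _ _ az E0) (away _ _ az E1)
  (away _ _ bz E0) (away _ _ bz E1).
move=> /(le_lt_trans Ns); rewrite ltr_nat => /far.
have := gdist_triangle (f a) p (f b); rewrite (gdist_sym p (f b)).
lia.
Qed.

End BigonImages.

Theorem theorem2p4 (R : realType) (X : graph) (x0 : X)
  (hX : bounded_degree X) (hfat : exp_many_fat_bigons R x0)
  (Y : graph) (hY : bounded_degree Y) (hhyp : hyperbolic R Y) :
  ~ (exists f : X -> Y, coarse_embedding R f).
Proof.
move=> [f [KR [rho [_ rho_oo emb]]]].
have [K fK] : exists K, forall u v, gdist (f u) (f v) <= K * gdist u v.
  exists (Num.truncn `|KR|%R).+1 => u v; rewrite -(ler_nat R) natrM.
  apply: le_trans (emb u v).2 _; rewrite ler_wpM2r//.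
  by apply: le_trans (ler_norm _) (ltW (truncnS_gt _)).
have [D hD] := hyperbolic_four_point hhyp.
have [dX ballX] := ball_cover hX; have [dY ballY] := ball_cover hY.
have [s0 [c [L [_ c1 L1 fat]]]] := hfat.
have [q cq] := exists_expr_ge (2 * dY.+1)%:R c1.
have q0 : 0 < q.
  rewrite lt0n; apply/negP => /eqP q0; move: cq.
  by rewrite q0 expr0 (ler_nat R _ 1); lia.
have [L' L'L] : exists L' : nat, (L <= L'%:R)%R.
  by exists (Num.truncn L).+1; exact/ltW/truncnS_gt.
have L'0 : 0 < L' by rewrite -(ltr_nat R); lra.
have [step stepE] : exists step, (K + D + 1) * (2 * L') = step by eexists.
have step0 : 0 < step by rewrite -stepE !muln_gt0 L'0 addn1.
pose r := step * q.
(* [N] depends on [r], hence on [q]; the bigons are then chosen [N]-fat. *)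
have [N far] : exists N, forall u v, N < gdist u v ->
    2 * (K * r.+1 + 2 * D) < gdist (f u) (f v).
  move/cvgnyPgt: rho_oo => /(_ (2 * (K * r.+1 + 2 * D))) [N _ NP]; exists N => u v uv.
  exact: leq_trans (NP _ (ltnW uv)) (emb u v).1.
have [C _ inf] := fat (Num.max s0 N%:R)%R ltac:(by rewrite le_max lexx).
have [C' C'C] : exists C' : nat, (C <= C'%:R)%R.
  by exists (Num.truncn C).+1; exact/ltW/truncnS_gt.
have [k near] : exists k, forall n x,
    bigon_vertices x0 L (Num.max s0 N%:R)%R C x -> gdist x0 x <= n ->
    gdist (f x0) (f x) <= (n + k) %/ q.
  pose E := K * C' + (K * r.+1 + 2 * D).
  exists (q * ((K + D + 1) * (E + 2) + E + 1)) => n x [p1 [p2 big]] xn.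
  rewrite leq_divRL//.
  have := bigon_image hD fK (erefl E) big L'L C'C _ far.
  rewrite le_max lexx orbT => /(_ isT).
  rewrite mulnA stepE /r -!mulnA -mulnDr leq_pmul2l// mulnC => /leq_trans.
  by apply; rewrite leq_add2r.
apply: (exp_growth_contradiction (M := dX.+1 ^ N) (k := k) q0 cq _ (ltn0Sn _) _).
  by lra.
apply: sub_infinite_set inf => n /= cn; apply: le_trans cn _; rewrite ler_nat.
have [S SM SP] := ballY (f x0) ((n + k) %/ q).
have [||s sM As] := @fiber_cover X Y f
  (bigon_vertices x0 L (Num.max s0 N%:R)%R C `&` vertex_ball x0 n) S (dX.+1 ^ N).
- by move=> x [bx xn]; apply: SP; apply: near bx xn.
- move=> x; have [s sN sP] := ballX x N; exists s => // x' fx; apply: sP.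
  by rewrite leqNgt; apply/negP => /far; rewrite fx gdistxx.
apply: leq_trans (card_fset_set_cover As) (leq_trans sM _).
by rewrite leq_mul2l SM orbT.
Qed.
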